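(* Let $\Sigma$ be a finite set of function symbols (the constructors) containing at least one constant, and consider first-order logic with equality $\approx$ over the signature $\Sigma$. Let $\mathcal{T}_{FT}$ be the set of logical consequences of the following axioms (free variables implicitly universally quantified): (A1) $\bigvee_{f \in \Sigma} \exists \overline{y}\, (x \approx f(\overline{y}))$; (A2) $f(\overline{x}) \not\approx g(\overline{y})$ for all $f,g \in \Sigma$ with $f \neq g$; (A3) $f(\overline{x}) \approx f(\overline{y}) \rightarrow \overline{x} \approx \overline{y}$ for every $f \in \Sigma$ of arity $\geq 1$; (A4) $t \not\approx x$ for every non-variable term $t$ over $\Sigma$ in which the variable $x$ occurs. Let $\mathit{Sub}$ be a new binary predicate symbol, and let $\mathcal{T}_{FT}^+$ be the set of logical consequences (in the signature $\Sigma \cup \{\mathit{Sub}\}$) of the axioms (A1), (A2), (A3) together with: (B1) $\mathit{Sub}(x_i, f(x_1, \dots, x_i, \dots, x_n))$ for every $f \in \Sigma$ of arity $n \geq 1$ and every $i$ with $1 \leq i \leq n$; (B2) $\mathit{Sub}(x,y) \land \mathit{Sub}(y,z) \rightarrow \mathit{Sub}(x,z)$; (B3) $\lnot \mathit{Sub}(x,x)$. Then $\mathcal{T}_{FT}^+$ is a conservative extension of $\mathcal{T}_{FT}$, that is: (1) every sentence in $\mathcal{T}_{FT}$ belongs to $\mathcal{T}_{FT}^+$; and (2) every sentence in $\mathcal{T}_{FT}^+$ that uses only symbols from $\Sigma$ (i.e., does not contain the predicate $\mathit{Sub}$) belongs to $\mathcal{T}_{FT}$.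
   Context: $\mathcal{T}_{FT}$ is the first-order theory of finite term algebras over $\Sigma$ (the $\Sigma$-term algebra has as carrier the set of ground terms over $\Sigma$, each ground term interpreted as itself). In (A1), $\overline{y}$ denotes a tuple of distinct variables of length equal to the arity of $f$; in (A2), (A3), $\overline{x}, \overline{y}$ are tuples of distinct variables of the appropriate arities, and $\overline{x} \approx \overline{y}$ denotes the componentwise conjunction of equalities. A ''theorem'' of a theory given by axioms means a sentence that is a logical consequence of those axioms. *)

(* Defs.v *)
From mathcomp Require Import all_boot.

Set Implicit Arguments.
Unset Strict Implicit.
Unset Printing Implicit Defensive.

(** * First-order logic with equality *)

(* Function symbols and predicate symbols are kept in separate records, so that
   languages with the same function symbols have literally the same terms. *)
Record fsig := FSig { fsym :> finType; arity : fsym -> nat }.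
Record psig := PSig { psym :> Type; parity : psym -> nat }.

Inductive term (Sigma : fsig) : Type :=
  | Var of nat
  | App (f : Sigma) of {ffun 'I_(arity f) -> term Sigma}.

Arguments Var {Sigma}.
Arguments App {Sigma}.

Inductive formula (Sigma : fsig) (Pi : psig) : Type :=
  | Eq of term Sigma & term Sigma
  | Pred (p : Pi) of {ffun 'I_(parity p) -> term Sigma}
  | Bot
  | Not of formula Sigma Pi
  | And of formula Sigma Pi & formula Sigma Pi
  | Or of formula Sigma Pi & formula Sigma Pi
  | Imp of formula Sigma Pi & formula Sigma Pi
  | All of nat & formula Sigma Pi
  | Ex of nat & formula Sigma Pi.

Arguments Eq {Sigma Pi}.
Arguments Pred {Sigma Pi}.
Arguments Bot {Sigma Pi}.

Definition bigOr (Sigma : fsig) (Pi : psig) (s : seq (formula Sigma Pi)) :=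
  foldr (@Or Sigma Pi) Bot s.

Definition bigAnd (Sigma : fsig) (Pi : psig) (s : seq (formula Sigma Pi)) :=
  foldr (@And Sigma Pi) (Not Bot) s.

Definition exs (Sigma : fsig) (Pi : psig) (xs : seq nat)
    (phi : formula Sigma Pi) :=
  foldr (@Ex Sigma Pi) phi xs.

Definition is_var (Sigma : fsig) (t : term Sigma) : bool :=
  if t is Var _ then true else false.

Fixpoint occurs (Sigma : fsig) (x : nat) (t : term Sigma) : bool :=
  match t with
  | Var y => x == y
  | App f a => [exists i, occurs x (a i)]
  end.

Fixpoint free (Sigma : fsig) (Pi : psig) (x : nat) (phi : formula Sigma Pi) :
    bool :=
  match phi with
  | Eq t u => occurs x t || occurs x u
  | Pred p a => [exists i, occurs x (a i)]
  | Bot => false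
  | Not psi => free x psi
  | And psi chi | Or psi chi | Imp psi chi => free x psi || free x chi
  | All y psi | Ex y psi => (x != y) && free x psi
  end.

Definition sentence (Sigma : fsig) (Pi : psig) (phi : formula Sigma Pi) :=
  forall x, ~~ free x phi.

Record structure (Sigma : fsig) (Pi : psig) := Structure {
  dom : Type;
  dom_inhabited : inhabited dom;
  fint : forall f : Sigma, {ffun 'I_(arity f) -> dom} -> dom;
  pint : forall p : Pi, {ffun 'I_(parity p) -> dom} -> Prop
}.

Fixpoint eval (Sigma : fsig) (Pi : psig) (M : structure Sigma Pi)
    (v : nat -> dom M) (t : term Sigma) : dom M :=
  match t with
  | Var x => v x
  | App f a => fint [ffun i => eval v (a i)]
  end.

Definition update (D : Type) (v : nat -> D) (x : nat) (d : D) : nat -> D :=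
  fun y => if y == x then d else v y.

Fixpoint sat (Sigma : fsig) (Pi : psig) (M : structure Sigma Pi)
    (v : nat -> dom M) (phi : formula Sigma Pi) : Prop :=
  match phi with
  | Eq t u => eval v t = eval v u
  | Pred p a => pint [ffun i => eval v (a i)]
  | Bot => False
  | Not psi => ~ sat v psi
  | And psi chi => sat v psi /\ sat v chi
  | Or psi chi => sat v psi \/ sat v chi
  | Imp psi chi => sat v psi -> sat v chi
  | All x psi => forall d, sat (update v x d) psi
  | Ex x psi => exists d, sat (update v x d) psi
  end.

(* Free variables are read as universally quantified. *)
Definition valid (Sigma : fsig) (Pi : psig) (M : structure Sigma Pi)
    (phi : formula Sigma Pi) : Prop :=
  forall v : nat -> dom M, sat v phi.

Definition entails (Sigma : fsig) (Pi : psig) (Ax : formula Sigma Pi -> Prop)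
    (phi : formula Sigma Pi) : Prop :=
  forall M : structure Sigma Pi, (forall psi, Ax psi -> valid M psi) ->
    valid M phi.

Definition theory (Sigma : fsig) (Pi : psig) (Ax : formula Sigma Pi -> Prop)
    (phi : formula Sigma Pi) : Prop :=
  sentence phi /\ entails Ax phi.

(** * Finite term algebras *)

(* [f(x_k, ..., x_(k+n-1))], where [n] is the arity of [f]. *)
Definition app_vars (Sigma : fsig) (f : Sigma) (k : nat) : term Sigma :=
  App f [ffun i : 'I_(arity f) => Var (k + i)].

Inductive constructor_axiom (Sigma : fsig) (Pi : psig) :
    formula Sigma Pi -> Prop :=
  | A1 : constructor_axiom
      (bigOr [seq exs (iota 1 (arity f)) (Eq (Var 0) (app_vars f 1))
             | f <- enum Sigma])
  | A2 (f g : Sigma) of f != g : constructor_axiom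
      (Not (Eq (app_vars f 0) (app_vars g (arity f))))
  | A3 (f : Sigma) of 0 < arity f : constructor_axiom
      (Imp (Eq (app_vars f 0) (app_vars f (arity f)))
           (bigAnd [seq Eq (Var i) (Var (arity f + i))
                   | i <- iota 0 (arity f)])).

Definition no_pred : psig := PSig (of_void nat).

Inductive FT_axiom (Sigma : fsig) : formula Sigma no_pred -> Prop :=
  | FT_constructor phi of constructor_axiom phi : FT_axiom phi
  | A4 (t : term Sigma) (x : nat) of ~~ is_var t & occurs x t :
      FT_axiom (Not (Eq t (Var x))).

Definition T_FT (Sigma : fsig) : formula Sigma no_pred -> Prop :=
  theory (@FT_axiom Sigma).

Variant sub_symbol := Sub_sym.

Definition sub_pred : psig := PSig (fun _ : sub_symbol => 2).

Definition Sub_atom (Sigma : fsig) (t u : term Sigma) :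
    formula Sigma sub_pred :=
  @Pred Sigma sub_pred Sub_sym [ffun i : 'I_2 => if val i == 0 then t else u].

Inductive FT_plus_axiom (Sigma : fsig) : formula Sigma sub_pred -> Prop :=
  | FT_plus_constructor phi of constructor_axiom phi : FT_plus_axiom phi
  | B1 (f : Sigma) (i : 'I_(arity f)) :
      FT_plus_axiom (Sub_atom (Var i) (app_vars f 0))
  | B2 : FT_plus_axiom
      (Imp (And (Sub_atom (Var 0) (Var 1)) (Sub_atom (Var 1) (Var 2)))
           (Sub_atom (Var 0) (Var 2)))
  | B3 : FT_plus_axiom (Not (Sub_atom (Var 0) (Var 0))).

Definition T_FT_plus (Sigma : fsig) : formula Sigma sub_pred -> Prop :=
  theory (@FT_plus_axiom Sigma).

(* The inclusion of the formulas over [Sigma] into those over [Sigma] and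
   [Sub]. *)
Fixpoint embed (Sigma : fsig) (phi : formula Sigma no_pred) :
    formula Sigma sub_pred :=
  match phi with
  | Eq t u => Eq t u
  | Pred p _ => match p with end
  | Bot => Bot
  | Not psi => Not (embed psi)
  | And psi chi => And (embed psi) (embed chi)
  | Or psi chi => Or (embed psi) (embed chi)
  | Imp psi chi => Imp (embed psi) (embed chi)
  | All x psi => All x (embed psi)
  | Ex x psi => Ex x (embed psi)
  end.

Fixpoint Sub_free (Sigma : fsig) (phi : formula Sigma sub_pred) : bool :=
  match phi with
  | Pred _ _ => false
  | Eq _ _ | Bot => true
  | Not psi | All _ psi | Ex _ psi => Sub_free psi
  | And psi chi | Or psi chi | Imp psi chi => Sub_free psi && Sub_free chi
  end.

(* Main.v *)
Require Import Defs.
From mathcomp Require Import all_boot.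
From Stdlib Require Import Relation_Operators Operators_Properties.

Set Implicit Arguments.
Unset Strict Implicit.
Unset Printing Implicit Defensive.

(* In a model of (B1)-(B3), a variable occurring in a non-variable term [t] has
   a value [Sub]-below that of [t], which gives (A4).  Conversely, every model
   of [T_FT] expands to a model of [T_FT_plus]: interpret [Sub] as the
   transitive closure of "being an argument of".  A cycle of this relation
   through [d] composes to a term [t(x, ...)] with value [d] at [x = d], the
   siblings along the cycle being values of fresh variables; so (A4) gives
   (B3). *)

(** The arguments of [App] are nested inside a finite function, so the induction hypothesis for each
    [a i] is built by an explicit [fix]. *)
Lemma term_induction (Sigma : fsig) (P : term Sigma -> Prop) :
  (forall x, P (Var x)) ->
  (forall f (a : {ffun 'I_(arity f) -> term Sigma}),
     (forall i, P (a i)) -> P (App f a)) ->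
  forall t, P t.
Proof.
move=> PVar PApp; fix IH 1 => -[x | f a]; first exact: PVar.
by apply: PApp => i; apply: IH.
Qed.

(** * Passing formulas and structures between the languages with and without [Sub] *)

Section Embedding.

Variable Sigma : fsig.
Implicit Types (phi : formula Sigma no_pred) (psi : formula Sigma sub_pred).

Lemma free_embed x phi : free x (embed phi) = free x phi.
Proof.
by elim: phi => //= [[] | ? -> ? -> | ? -> ? -> | ? -> ? -> | ? ? -> | ? ? ->].
Qed.

Lemma sentence_embed phi : sentence (embed phi) <-> sentence phi.
Proof. by split=> sen x; move: (sen x); rewrite free_embed. Qed.

Lemma Sub_free_embedP psi : Sub_free psi -> exists phi, psi = embed phi.
Proof.
elim: psi => //=.
- by move=> t u _; exists (Eq t u).
- by exists Bot.
- by move=> psi IH /IH[phi ->]; exists (Not phi).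
- by move=> p1 IH1 p2 IH2 /andP[/IH1[q1 ->] /IH2[q2 ->]]; exists (And q1 q2).
- by move=> p1 IH1 p2 IH2 /andP[/IH1[q1 ->] /IH2[q2 ->]]; exists (Or q1 q2).
- by move=> p1 IH1 p2 IH2 /andP[/IH1[q1 ->] /IH2[q2 ->]]; exists (Imp q1 q2).
- by move=> x psi IH /IH[phi ->]; exists (All x phi).
- by move=> x psi IH /IH[phi ->]; exists (Ex x phi).
Qed.

Lemma embed_bigOr (s : seq (formula Sigma no_pred)) :
  embed (bigOr s) = bigOr [seq embed phi | phi <- s].
Proof. by elim: s => //= phi s ->. Qed.

Lemma embed_bigAnd (s : seq (formula Sigma no_pred)) :
  embed (bigAnd s) = bigAnd [seq embed phi | phi <- s].
Proof. by elim: s => //= phi s ->. Qed.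

Lemma embed_exs xs phi : embed (exs xs phi) = exs xs (embed phi).
Proof. by elim: xs => //= x xs ->. Qed.

Lemma embed_A1 :
  embed (bigOr [seq exs (iota 1 (arity f)) (Eq (Var 0) (app_vars f 1))
               | f <- enum Sigma])
  = bigOr [seq exs (iota 1 (arity f)) (Eq (Var 0) (app_vars f 1))
          | f <- enum Sigma].
Proof.
rewrite embed_bigOr -map_comp; congr bigOr.
by apply: eq_map => f /=; rewrite embed_exs.
Qed.

Lemma embed_A3 (f : Sigma) :
  embed (Imp (Eq (app_vars f 0) (app_vars f (arity f)))
             (bigAnd [seq Eq (Var i) (Var (arity f + i))
                     | i <- iota 0 (arity f)]))
  = Imp (Eq (app_vars f 0) (app_vars f (arity f)))
        (bigAnd [seq Eq (Var i) (Var (arity f + i)) | i <- iota 0 (arity f)]).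
Proof. by rewrite /= embed_bigAnd -map_comp. Qed.

Lemma constructor_axiom_embed phi :
  constructor_axiom phi -> constructor_axiom (embed phi).
Proof.
case=> [|f g fg|f f_gt0]; first by rewrite embed_A1; apply: A1.
  exact: A2.
by rewrite embed_A3; apply: A3.
Qed.

Lemma constructor_axiom_embedP psi : constructor_axiom psi ->
  exists2 phi, psi = embed phi & constructor_axiom phi.
Proof.
case=> [|f g fg|f f_gt0].
- by eexists; [rewrite -embed_A1 | apply: A1].
- by exists (Not (Eq (app_vars f 0) (app_vars g (arity f)))); last exact: A2.
- by eexists; [rewrite -embed_A3 | apply: A3].
Qed.

Section Expansion.

Variable M : structure Sigma no_pred.
Variable P : forall p : sub_pred, {ffun 'I_(parity p) -> dom M} -> Prop.

Definition expand : structure Sigma sub_pred :=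
  Structure (dom_inhabited M) (@fint _ _ M) P.

Lemma eval_expand (v : nat -> dom M) t :
  @eval _ _ expand v t = @eval _ _ M v t.
Proof.
elim/term_induction: t => //= f a IH; congr fint.
by apply/ffunP => i; rewrite !ffunE.
Qed.

Lemma sat_expand phi (v : nat -> dom M) :
  @sat _ _ expand v (embed phi) <-> @sat _ _ M v phi.
Proof.
elim: phi v => /= [t u|[]||p IH|p IHp q IHq|p IHp q IHq|p IHp q IHq|x p IH
  |x p IH] v //.
- by rewrite !eval_expand.
- by have := IH v; tauto.
- by have := IHp v; have := IHq v; tauto.
- by have := IHp v; have := IHq v; tauto.
- by have := IHp v; have := IHq v; tauto.
- by split=> H d; apply/IH.
- by split=> -[d /IH H]; exists d.
Qed.

Lemma valid_expand phi : valid expand (embed phi) <-> valid M phi.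
Proof. by split=> H v; apply/sat_expand; apply: H. Qed.

End Expansion.

Definition reduct (N : structure Sigma sub_pred) : structure Sigma no_pred :=
  @Structure _ no_pred _ (dom_inhabited N) (@fint _ _ N)
    (fun p _ => match p with end).

(** Makes the preservation of truth under reducts an instance of that under expansions. *)
Lemma expand_reduct (N : structure Sigma sub_pred) :
  expand (M := reduct N) (@pint _ _ N) = N.
Proof. by case: N. Qed.

Lemma valid_reduct (N : structure Sigma sub_pred) phi :
  valid N (embed phi) <-> valid (reduct N) phi.
Proof. by rewrite -{1}(expand_reduct N); apply: valid_expand. Qed.

End Embedding.

(** * Reducts of models of (A1)-(A3), (B1)-(B3) satisfy (A4) *)

Section Subterms.

Variables (Sigma : fsig) (N : structure Sigma sub_pred).
Hypothesis N_model : forall psi, FT_plus_axiom psi -> valid N psi.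

Definition Sub_rel (a b : dom N) : Prop :=
  @pint _ _ N Sub_sym [ffun i : 'I_2 => if val i == 0 then a else b].

Lemma sat_Sub_atom (v : nat -> dom N) (t u : term Sigma) :
  sat v (Sub_atom t u) <-> Sub_rel (eval v t) (eval v u).
Proof.
rewrite /Sub_rel /=; set a := finfun _; set b := finfun _.
suff -> : a = b by [].
by apply/ffunP => i; rewrite !ffunE; case: ifP.
Qed.

Lemma Sub_rel_fint (f : Sigma) (a : {ffun 'I_(arity f) -> dom N}) i :
  Sub_rel (a i) (fint a).
Proof.
(* Variable [j] takes the value [a j]; the default [a i] only concerns indices from [arity f] on,
   which do not occur in (B1). *)
pose v y := oapp a (a i) (insub y).
have /sat_Sub_atom := N_model (B1 i) v.
rewrite /= {1}/v valK /=; set b := finfun _; suff -> : b = a by [].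
by apply/ffunP => j; rewrite !ffunE /= add0n /v valK.
Qed.

Lemma Sub_rel_trans a b c : Sub_rel a b -> Sub_rel b c -> Sub_rel a c.
Proof.
(* The default [c] of [nth] is the value of variable 2. *)
move=> ab bc; pose v n := nth c [:: a; b] n.
have /= H := N_model (B2 Sigma) v.
apply/(sat_Sub_atom v (Var 0) (Var 2)); apply: H.
by split; [apply/(sat_Sub_atom v (Var 0) (Var 1))
          | apply/(sat_Sub_atom v (Var 1) (Var 2))].
Qed.

Lemma Sub_rel_irrefl a : ~ Sub_rel a a.
Proof.
move=> aa; apply: (N_model (B3 Sigma) (fun=> a)).
exact/sat_Sub_atom.
Qed.

(** By (B1) the argument containing [x] is below the whole term. Either it is [x] itself, or the
    induction hypothesis puts [x] below it and (B2) concludes. *)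
Lemma Sub_rel_occurs (v : nat -> dom N) x (t : term Sigma) :
  ~~ is_var t -> occurs x t -> Sub_rel (v x) (eval v t).
Proof.
elim/term_induction: t => //= f a IH _ /existsP[i xi].
have := Sub_rel_fint [ffun j => eval v (a j)] i; rewrite ffunE => ai.
case: (boolP (is_var (a i))) => [|/IH/(_ xi) xa].
  by case: (a i) xi ai => //= y /eqP->.
exact: Sub_rel_trans xa ai.
Qed.

Lemma reduct_model phi : FT_axiom phi -> valid (reduct N) phi.
Proof.
move=> phiP; apply/valid_reduct.
case: phiP => {phi} [phi /constructor_axiom_embed H|t x tN xt v].
  by apply: N_model; apply: FT_plus_constructor.
move=> /= tx; apply: (@Sub_rel_irrefl (v x)).
by rewrite -{2}tx; apply: Sub_rel_occurs.
Qed.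

End Subterms.

(** * Expanding a model of the term algebra axioms by a subterm relation *)

Section TransitiveClosure.

Variables (Sigma : fsig) (M : structure Sigma no_pred).
Hypothesis M_model : forall phi, FT_axiom phi -> valid M phi.

Definition argument (a b : dom M) : Prop :=
  exists (f : Sigma) (c : {ffun 'I_(arity f) -> dom M}) i,
    a = c i /\ b = fint c.

(** Taking a transitive closure yields (B1) and (B2) by construction, which leaves (B3) to be
    derived from (A4). *)
Definition subterm : dom M -> dom M -> Prop := clos_trans _ argument.

(* Quantifying over all valuations that agree with [v] below [n] makes [n] a
   bound on the variables of [t]; the variables from [n] on are fresh. *)
Definition term_between (nonvar : bool) (a b : dom M) : Prop :=
  exists (t : term Sigma) (n : nat) (v : nat -> dom M),
    [/\ nonvar ==> ~~ is_var t, occurs 0 t, 0 < n, v 0 = a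
      & forall w : nat -> dom M, (forall y, y < n -> w y = v y) -> eval w t = b].

(** Applying [f] on top of [t] always gives a non-variable term, so [t] itself may still be a
    variable. *)
Lemma term_between_argument nonvar a b c :
  term_between nonvar a b -> argument b c -> term_between true a c.
Proof.
move=> [t [n [v [_ t0 n_gt0 v0 tE]]]] [f [e [i [bE ->]]]].
(* The sibling at position [j] becomes the fresh variable [n + j], which the new valuation sends to
   [e j]; below [n] it remains [v], so [t] keeps its value. *)
exists (App f [ffun j => if j == i then t else Var (n + j)]), (n + arity f).
exists (fun y => if y < n then v y else oapp e b (insub (y - n))).
split=> //=.
- by apply/existsP; exists i; rewrite ffunE eqxx.
- by rewrite addn_gt0 n_gt0.
- by rewrite n_gt0.
move=> w wE; congr fint; apply/ffunP => j; rewrite !ffunE.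
case: eqP => [-> | _] /=.
  rewrite -bE; apply: tE => y yn; rewrite wE ?yn //.
  exact: leq_trans yn (leq_addr _ _).
by rewrite wE ?ltn_add2l // ltnNge leq_addr /= addKn valK.
Qed.

Lemma subterm_term_between a b : subterm a b -> term_between true a b.
Proof.
(* This form of the closure adds steps at the upper end, where the term grows. The chain starts from
   the bare variable [Var 0], hence the flag [false]. *)
move/clos_trans_tn1_iff; elim=> {b} [b|b c bc _ ab].
  apply: (@term_between_argument false _ a).
  by exists (Var 0), 1, (fun=> a); split=> // w /= ->.
exact: term_between_argument ab bc.
Qed.

Lemma subterm_irrefl a : ~ subterm a a.
Proof.
move=> /subterm_term_between[t [n [v [tN t0 _ v0 tE]]]].
(* Under [v] both [t] and [Var 0] have the value [a], contrary to (A4). *)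
by have := M_model (A4 tN t0) v; apply; rewrite /= v0; apply: tE.
Qed.

Definition subterm_expansion : structure Sigma sub_pred :=
  @expand _ M (fun p (a : {ffun 'I_2 -> dom M}) =>
    subterm (a ord0) (a ord_max)).

Lemma subterm_expansion_model psi :
  FT_plus_axiom psi -> valid subterm_expansion psi.
Proof.
case=> {psi} [psi /constructor_axiom_embedP[phi -> phiP]|f i||] => [|v|v|v].
- by apply/valid_expand; apply: M_model; apply: FT_constructor.
- rewrite /= !ffunE /=; apply: t_step; exists f.
  exists [ffun j : 'I_(arity f) => v j], i; rewrite ffunE; split=> //.
  by congr fint; apply/ffunP => j; rewrite !ffunE.
- by rewrite /= !ffunE /= => -[]; apply: t_trans.
- by rewrite /= !ffunE /=; apply: subterm_irrefl.
Qed.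

End TransitiveClosure.

Theorem theorem3 (Sigma : fsig) (has_constant : exists c : Sigma, arity c = 0) :
  (forall phi : formula Sigma no_pred, T_FT phi -> T_FT_plus (embed phi)) /\
  (forall psi : formula Sigma sub_pred, T_FT_plus psi -> Sub_free psi ->
     exists2 phi : formula Sigma no_pred, psi = embed phi & T_FT phi).
Proof.
split=> [phi [sen ent] | psi [sen ent] /Sub_free_embedP[phi psiE]].
  split=> [|N N_model]; first exact/sentence_embed.
  by apply/valid_reduct; apply: ent; apply: reduct_model.
subst psi; exists phi => //; split=> [|M M_model]; first exact/sentence_embed.
(* Truth of [phi] in [M] is read off in the expansion of [M] by [subterm], to which the entailment
   applies. *)
by apply/valid_expand; apply: ent; apply: (subterm_expansion_model M_model).
Qed.
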